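(* Let $k\geq 2$ be an integer and let $p=c/n$ with a constant $0<c<c_{k+1}$. Then for every integer $m\geq 3$, $$\lim_{n\to\infty}\Pr\left[M(n,c,m)\geq m-k-2\right]=1.$$
   Context: $G(n,p)$ is the Erdős–Rényi random graph on $n$ vertices with each edge present independently with probability $p$. For a graph $G$, $D(G)=\max_H \delta(H)$ over induced subgraphs $H$ of $G$, where $\delta$ is minimum degree. For $k\ge 2$, $c_k:=\sup\{c>0:\lim_{n\to\infty}\Pr[D(G(n,c/n))\geq k]=0\}$. $K_m$ is the complete graph on $m$ vertices. For graphs $G,H$, $\mathrm{Hom}(G,H)$ is the polyhedral complex whose cells are functions $\eta:V(G)\to 2^{V(H)}\setminus\{\varnothing\}$ with $\eta(x)\times\eta(y)\subseteq E(H)$ whenever $\{x,y\}\in E(G)$; the cell $\eta$ is a product of simplices of dimension $\sum_v(|\eta(v)|-1)$, with face relation $\eta\subseteq\tau$ iff $\eta(v)\subseteq\tau(v)$ for all $v$. For a space $X$, $\mathrm{conn}(X)$ is the largest $j$ such that $X$ is $j$-connected, where $X$ is $j$-connected if it is nonempty (for $j\ge-1$) and $\pi_i(X)$ vanishes for $0\le i\le j$ (so nonempty disconnected spaces have $\mathrm{conn}=-1$). $M(n,c,m):=\mathrm{conn}[\mathrm{Hom}(G(n,c/n),K_m)]$. *)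

(* Defs.v *)
From HB Require Import structures.
From mathcomp Require Import all_boot all_order all_algebra.
From mathcomp Require Import all_classical all_reals all_analysis.
Set Implicit Arguments. Unset Strict Implicit. Unset Printing Implicit Defensive.
Import Order.TTheory GRing.Theory Num.Theory.
Import numFieldNormedType.Exports.
Local Open Scope classical_set_scope.
Local Open Scope ring_scope.

(* Unordered pairs {i,j} (i<j) encoded as ordered pairs with i < j. *)
Definition upairs (n : nat) : {set 'I_n * 'I_n} :=
  [set e : 'I_n * 'I_n | (e.1 < e.2)%N].

(* A graph on 'I_n is an edge set E \subset upairs n; adjacency: *)
Definition adj (n : nat) (E : {set 'I_n * 'I_n}) (u v : 'I_n) : bool :=
  ((u, v) \in E) || ((v, u) \in E).

Definition deg_in (n : nat) (E : {set 'I_n * 'I_n}) (S : {set 'I_n}) (v : 'I_n) : nat :=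
  #|[set u in S | adj E v u]|.

(* minimum degree of the induced subgraph G[S] (S nonempty); n is an upper bound *)
Definition mindeg_in (n : nat) (E : {set 'I_n * 'I_n}) (S : {set 'I_n}) : nat :=
  \big[minn/n]_(v in S) deg_in E S v.

Definition degen (n : nat) (E : {set 'I_n * 'I_n}) : nat :=
  \max_(S : {set 'I_n} | S != finset.set0) mindeg_in E S.

Definition Pr_Gnp {R : realType} (n : nat) (p : R)
  (P : {set 'I_n * 'I_n} -> Prop) : R :=
  \sum_(E in powerset (upairs n) | `[< P E >])
     p ^+ #|E| * (1 - p) ^+ (#|upairs n| - #|E|).
Arguments Pr_Gnp {R} n p P.

Definition c_thr {R : realType} (k : nat) : \bar R :=
  ereal_sup [set x%:E | x in
    [set c : R | 0 < c /\
       (fun n : nat => Pr_Gnp n (c / n%:R) (fun E => (k <= degen E)%N)) @ \oo --> 0]].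

(* The polyhedral complex Hom(G,H) (G on 'I_n with edges E, H on 'I_m with
   adjacency relation h) is realized as the subspace of the product of simplices
   (Delta^{V(H)})^{V(G)} inside 'M[R]_(n,m) consisting of points x (row v = a
   point of the simplex on V(H)) whose supports eta(v) = {a | x v a <> 0} form a
   cell: eta(u) x eta(v) \subset E(H) for every edge {u,v} of G. *)
Definition hom_space {R : realType} (n m : nat) (E : {set 'I_n * 'I_n})
  (h : rel 'I_m) : set 'M[R]_(n, m) :=
  [set x | (forall v a, 0 <= x v a) /\ (forall v, \sum_(a < m) x v a = 1) /\
     (forall u v, adj E u v -> forall a b, x u a != 0 -> x v b != 0 -> h a b)].

Definition K_rel (m : nat) : rel 'I_m := fun a b => a != b.
Arguments K_rel m : clear implicits.

Definition usphere {R : realType} (i : nat) : set 'rV[R]_(i.+1) :=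
  [set x | \sum_(j < i.+1) x ord0 j ^+ 2 = 1].
Definition udisk {R : realType} (i : nat) : set 'rV[R]_(i.+1) :=
  [set x | \sum_(j < i.+1) x ord0 j ^+ 2 <= 1].

(* pi_i(X) vanishes (at every base point): every continuous map S^i -> X
   extends continuously to D^(i+1) -> X  (for i = 0: X path-connected). *)
Definition pi_trivial {R : realType} (n m : nat) (X : set 'M[R]_(n, m)) (i : nat) : Prop :=
  forall f : 'rV[R]_(i.+1) -> 'M[R]_(n, m),
    {within (@usphere R i), continuous f} -> f @` (@usphere R i) `<=` X ->
    exists g : 'rV[R]_(i.+1) -> 'M[R]_(n, m),
      [/\ {within (@udisk R i), continuous g}, g @` (@udisk R i) `<=` X &
          forall x : 'rV[R]_(i.+1), (@usphere R i) x -> g x = f x].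

Definition j_connected {R : realType} (n m : nat) (X : set 'M[R]_(n, m)) (j : int) : Prop :=
  ((-1 <= j)%R -> X !=set0) /\ (forall i : nat, (i%:Z <= j)%R -> pi_trivial X i).

(* conn(X) >= j  iff  X is j-connected (with the convention conn(empty) = -2,
   so that conn(X) >= j holds vacuously for j <= -2). *)
Definition conn_ge {R : realType} (n m : nat) (X : set 'M[R]_(n, m)) (j : int) : Prop :=
  j_connected X j.

(* Main.v *)
(* If [degen E <= k], then adding the vertices one by one along a degeneracy
   order, each new vertex [v] has at most [k] earlier neighbours (Malen's
   argument). Let [F] map a sphere [S^(r-1)] to the complex of the larger graph,
   and let [G] extend its projection to the ball, in the complex of the smaller
   graph. By a cellular approximation that only shrinks supports, [G] can be
   assumed to use at most [k + r] colours on the neighbours of [v] at each point.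
   If [k + r < m], some colour has weight zero on all these neighbours, and
   [max 0 (e - (largest weight of the colour among the neighbours))] is,
   once normalized, a continuous choice of a point for [v], admissible after the
   weights at the other vertices are truncated at [e]. On the boundary one returns
   to [F] by linear homotopies, first moving [v] and then the other vertices.

   The approximation rounds the points of a fine grid as in the Kuhn
   triangulation: [s] is replaced by the integer points [p] with
   [s - t < p < s - t + 1], the time [t] running through [0, 1], and a colour
   is fixed for each vertex of the graph at each [p]. At most [r] changes of [p]
   occur in total; letting the vertex [u] of the graph look only at the times in
   [u/n, (u+1)/n] makes each change count for one vertex only, which is the
   dimension bound.

   On the probabilistic side, [k < degen E] is an increasing event, so its
   probability at [c/n] is at most the one at [c'/n] for some [c' > c] for which
   it tends to 0. *)
Require Import Defs.
From HB Require Import structures.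
From mathcomp Require Import all_boot all_order all_algebra.
From mathcomp Require Import all_classical all_reals all_analysis.
From mathcomp Require Import zify ring lra.
Import Order.TTheory GRing.Theory Num.Theory.
Import numFieldNormedType.Exports.
Local Open Scope classical_set_scope.
Local Open Scope ring_scope.

Set Implicit Arguments.
Unset Strict Implicit.

(** * Rounding weights of the Kuhn triangulation *)

Section Kuhn.
Variables (R : realType) (r D : nat).
Implicit Types (l h t : R) (s : 'I_r -> R) (p : {ffun 'I_r -> 'I_D.+1}).

(** The length of the interval of times [t] between [l] and [h] at which
    [s j - t < p j < s j - t + 1] for all [j], or 0 if there is none. *)
Definition kuhn_weight l h s p : R :=
  Num.max 0 (\big[Num.min/h]_j (s j - (p j)%:R + 1)
             - \big[Num.max/l]_j (s j - (p j)%:R)).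

Lemma kuhn_weight_ge0 l h s p : 0 <= kuhn_weight l h s p.
Proof. by rewrite le_max lexx. Qed.

Lemma kuhn_weight_gt0 l h s p : 0 < kuhn_weight l h s p ->
  exists t, [/\ l < t, t < h & forall j, s j - t < (p j)%:R < s j - t + 1].
Proof.
rewrite /kuhn_weight; set hi := \big[Num.min/h]_j _; set lo := \big[Num.max/l]_j _.
rewrite lt_max ltxx /= subr_gt0 => lohi; exists ((lo + hi) / 2).
have [lot thi] : lo < (lo + hi) / 2 /\ (lo + hi) / 2 < hi by split; lra.
have llo : l <= lo by apply: bigmax_ge_id.
have hih : hi <= h by apply: bigmin_le_id.
split; [lra|lra|move=> j].
have h1 : s j - (p j)%:R <= lo by exact: (le_bigmax _ (fun j => s j - (p j)%:R)).
have h2 : hi <= s j - (p j)%:R + 1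
  by exact: (bigmin_le _ j (fun j => s j - (p j)%:R + 1)).
by apply/andP; split; lra.
Qed.

(** For nonnegative [s] and generic [t] in [[0, 1]], the coordinate sum of the integer point
    selected at time [t]. *)
Definition kuhn_level s t : nat := (\sum_(j < r) Num.truncn (s j + 1 - t))%N.

(** The point selected just before time [h] has as coordinates the integer parts of [s j + 1 - h];
    [0 <= l < h] keeps them at most [D]. *)
Lemma kuhn_weight_ex l h s : 0 <= l -> l < h -> h <= 1 ->
  (forall j, 0 <= s j <= D%:R) -> exists p, 0 < kuhn_weight l h s p.
Proof.
move=> l0 lh h1 sD.
have tr j : (Num.truncn (s j + 1 - h))%:R <= s j + 1 - h
    < (Num.truncn (s j + 1 - h)).+1%:R.
  by apply/truncn_itv; have /andP[] := sD j; lra.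
have trD j : (Num.truncn (s j + 1 - h) < D.+1)%N.
  rewrite -(ltr_nat R) -natr1; have /andP[] := tr j; have /andP[] := sD j; lra.
exists [ffun j => Ordinal (trD j)]; rewrite lt_max ltxx /= subr_gt0.
have maxh : \big[Num.max/l]_j (s j - ([ffun j => Ordinal (trD j)] j)%:R) < h.
  apply: bigmax_lt => // j _; rewrite ffunE /=.
  by have /andP[_] := tr j; rewrite -natr1; lra.
apply: lt_le_trans maxh _; apply: le_bigmin => // j _; rewrite ffunE /=.
by have /andP[+ _] := tr j; lra.
Qed.

(** Selected points decrease coordinatewise as time passes. *)
Lemma kuhn_weight_chain l h s p p' :
  0 < kuhn_weight l h s p -> 0 < kuhn_weight l h s p' ->
  (forall j, (p' j <= p j)%N) \/ (forall j, (p j <= p' j)%N).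
Proof.
move=> /kuhn_weight_gt0[t [_ _ tp]] /kuhn_weight_gt0[t' [_ _ tp']].
by have [tt'|tt'] := leP t t'; [left|right] => j; rewrite -ltnS -(ltr_nat R) -natr1;
  have /andP[] := tp j; have /andP[] := tp' j; lra.
Qed.

Lemma kuhn_weight_level l h s p : l <= 1 -> (forall j, 0 <= s j) ->
  0 < kuhn_weight l h s p ->
  (kuhn_level s h <= \sum_j p j <= kuhn_level s l)%N.
Proof.
move=> l1 s0 /kuhn_weight_gt0[t [lt th tp]].
apply/andP; split; apply: leq_sum => j _;
  have /andP[tp1 tp2] := tp j; have := s0 j => sj0.
  by rewrite truncn_le_nat -natr1; lra.
by rewrite truncn_ge_nat; lra.
Qed.

(** By the chain property the coordinate sum is injective on the points of positive weight, and its
    values lie between the levels at [h] and at [l]. *)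
Lemma kuhn_weight_card l h s : l <= h -> l <= 1 -> (forall j, 0 <= s j) ->
  (#|[set p | (0 < kuhn_weight l h s p)%R]%SET| + kuhn_level s h
     <= (kuhn_level s l).+1)%N.
Proof.
move=> lh l1 s0; set P : {set {ffun 'I_r -> 'I_D.+1}} := [set p | _]%SET.
have lv p : p \in P -> (kuhn_level s h <= \sum_j p j <= kuhn_level s l)%N.
  by rewrite inE; apply: kuhn_weight_level.
have le_level : (kuhn_level s h <= kuhn_level s l)%N.
  by apply: leq_sum => j _; apply: le_truncn; lra.
pose N := (kuhn_level s l - kuhn_level s h)%N.
pose f p : 'I_N.+1 := inord (\sum_j p j - kuhn_level s h)%N.
have f_inj : {in P &, injective f}.
  move=> p p' pP p'P /(congr1 (@nat_of_ord _)).
  have [/andP[lp hp] /andP[lp' hp']] := (lv _ pP, lv _ p'P).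
  rewrite /f !inordK ?ltnS ?leq_sub2r// => e.
  have {e} e : (\sum_j p j = \sum_j p' j)%N.
    by rewrite -(subnK lp) -(subnK lp') e.
  have inj (q q' : {ffun 'I_r -> 'I_D.+1}) : (forall j, (q' j <= q j)%N) ->
      (\sum_j q j = \sum_j q' j)%N -> q = q'.
    move=> qq' eqs; apply/ffunP => j; apply/val_inj/eqP.
    have := @leqif_sum _ predT _ _ _ (fun j _ => leqif_eq (qq' j)).
    by move=> /leqifP; case: ifPn => [/forall_inP/(_ j isT)|_];
      rewrite eqs ?ltnn// eq_sym.
  move: pP p'P; rewrite !inE => pP p'P.
  by have [/inj->//|/inj<-//] := kuhn_weight_chain pP p'P.
have := max_card (f @: P); rewrite card_in_imset // card_ord /N.
move: le_level #|P|; move: (kuhn_level _ _) (kuhn_level _ _) => a b ab c; lia.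
Qed.

End Kuhn.

(** * Pointwise continuity, the sup norm and a compactness bound *)

Section Continuity.
Variables (R : realType) (T : topologicalType).

Lemma continuous_maxr (f g : T -> R) (x : T) :
  continuous_at x f -> continuous_at x g ->
  continuous_at x (fun y => Num.max (f y) (g y)).
Proof. exact: continuous_max. Qed.

Lemma continuous_minr (f g : T -> R) (x : T) :
  continuous_at x f -> continuous_at x g ->
  continuous_at x (fun y => Num.min (f y) (g y)).
Proof. exact: continuous_min. Qed.

Lemma continuous_addr (f g : T -> R) (x : T) :
  continuous_at x f -> continuous_at x g -> continuous_at x (fun y => f y + g y).
Proof. exact: (@continuousD R R^o). Qed.

Lemma continuous_subr (f g : T -> R) (x : T) :
  continuous_at x f -> continuous_at x g -> continuous_at x (fun y => f y - g y).
Proof. exact: (@continuousB R R^o). Qed.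

Lemma continuous_mulr (f g : T -> R) (x : T) :
  continuous_at x f -> continuous_at x g -> continuous_at x (fun y => f y * g y).
Proof. exact: continuousM. Qed.

Lemma continuous_sumr (I : Type) (s : seq I) (P : pred I) (f : I -> T -> R) :
  (forall i, P i -> continuous (f i)) ->
  continuous (fun y => \sum_(i <- s | P i) f i y).
Proof. by move=> fC; apply: continuous_big => //; exact: add_continuous. Qed.
End Continuity.

Section MatrixNorm.
Variables (R : realType) (r : nat).

Lemma row_norm_le (y : 'rV[R]_r) (K : R) : 0 <= K ->
  (forall j, `|y ord0 j| <= K) -> `|y| <= K.
Proof.
move=> K0 yK; rewrite [leLHS]/Num.norm /= mx_normrE; apply: bigmax_le => // -[i j] _ /=.
by rewrite ord1.
Qed.

Lemma row_coord_norm_le (y : 'rV[R]_r) (j : 'I_r) : `|y ord0 j| <= `|y|.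
Proof.
rewrite [leRHS]/Num.norm /= mx_normrE.
exact: (le_bigmax _ (fun i : 'I_1 * 'I_r => `|y i.1 i.2|) (ord0, j)).
Qed.
End MatrixNorm.

Lemma continuous_mx (R : realType) (T : topologicalType) n m (f : T -> 'M[R]_(n, m)) x :
  (forall u a, continuous_at x (fun y => f y u a)) -> continuous_at x f.
Proof.
move=> fC A [P fxP PA]; rewrite /nbhs /=.
apply: filterS (_ : \forall y \near x, forall u a, P u a (f y u a)).
  by move=> y Py; apply: PA.
by apply: filter_forall => u; apply: filter_forall => a; apply: fC; exact: fxP.
Qed.

(** Around each centre the entries stay within [e / 2] of their values there; compactness of the
    ball makes the radius uniform. Only [q] is confined to the ball. *)
Lemma uniform_support (R : realType) (r n m : nat)
    (G : 'rV[R]_r -> 'I_n -> 'I_m -> R) (K e : R) :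
  (forall u a, continuous (fun y => G y u a)) -> 0 < K -> 0 < e ->
  exists2 d : R, 0 < d & forall q q' : 'rV[R]_r, `|q| <= K -> `|q' - q| <= d ->
    forall u a, e <= G q u a -> 0 < G q' u a.
Proof.
move=> GC K0 e0.
have cptK : compact [set q : 'rV[R]_r | `|q| <= K].
  apply: bounded_closed_compact.
    exists K; split; first exact: gtr0_real.
    by move=> M KM q /= qK; rewrite (le_trans qK)// ltW.
  apply: (@closed_comp _ _ (fun q : 'rV[R]_r => `|q|) [set t | t <= K]).
    by move=> q _; exact: norm_continuous.
  exact: closed_le.
pose Pd (d : R) (q : 'rV[R]_r) := forall q' : 'rV[R]_r, `|q' - q| <= d ->
    forall u a, e <= G q u a -> 0 < G q' u a.
suff: \forall d \near 0^'+, [set q : 'rV[R]_r | `|q| <= K] `<=` Pd d.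
  move=> H.
  have /filter_ex[d [d0 Kd]] : \forall d \near (0 : R)^'+,
      0 < d /\ [set q : 'rV[R]_r | `|q| <= K] `<=` Pd d.
    by apply: (@filterI _ (0^'+) _ (fun d => 0 < d)) => //; exact: nbhs_right_gt.
  by exists d => // q q' qK; exact: (Kd q qK q').
(* In the near-covering form of compactness it suffices to treat the points close to a given [q]
   together with all small [d]. *)
move/compact_near_coveringP : cptK; apply.
move=> q _.
have [d d0 dG] : exists2 d : R, 0 < d & forall q' : 'rV[R]_r, `|q' - q| < d ->
    forall u a, `|G q' u a - G q u a| < e / 2.
  have : \forall q' \near q, forall u a, `|G q' u a - G q u a| < e / 2.
    apply: (@filter_forall _ _ _ (nbhs q) _) => u.
    apply: (@filter_forall _ _ _ (nbhs q) _) => a.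
    have /cvgr_dist_lt := GC u a q.
    by move=> /(_ (e / 2)); rewrite divr_gt0// => /(_ isT);
      apply: filterS => z; rewrite distrC.
  move=> /nbhs_ballP[d /= d0 dG]; exists d => // q' qq'; apply: dG.
  by rewrite -ball_normE /= distrC.
near=> q0 d1 => /= q' q'q0 u a.
have q0d : `|q0 - q| < d / 2.
  near: q0; apply/nbhs_ballP; exists (d / 2) => /=; rewrite ?divr_gt0// => z.
  by rewrite -ball_normE /= distrC.
have d1d : d1 < d / 2 by near: d1; apply: nbhs_right_lt; rewrite divr_gt0.
have h0 := dG q0.
have h1 : `|q' - q| < d.
  rewrite -[q' - q](subrKA q0) (le_lt_trans (ler_normD _ _))//.
  lra.
have := dG _ h1 u a; have q0d' : `|q0 - q| < d by lra.
have := h0 q0d' u a; rewrite !ltr_norml => /andP[_ +] /andP[+ _].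
lra.
Unshelve. all: by end_near.
Qed.

(** * Cellular approximation that only shrinks supports *)

Section CellularApproximation.
Variables (R : realType) (n m : nat).

Definition stochastic (x : 'I_n -> 'I_m -> R) : Prop :=
  (forall u a, 0 <= x u a) /\ (forall u, \sum_a x u a = 1).

Definition normalized (w : 'I_m -> R) (a : 'I_m) : R := w a / \sum_b w b.

Lemma normalized_ge0 w a : (forall b, 0 <= w b) -> 0 <= normalized w a.
Proof. by move=> w0; rewrite divr_ge0// sumr_ge0. Qed.

Lemma normalized_sum w : 0 < \sum_b w b -> \sum_a normalized w a = 1.
Proof. by move=> w0; rewrite -mulr_suml divff// gt_eqF. Qed.

Lemma normalized_neq0 w a : normalized w a != 0 -> w a != 0.
Proof. by apply: contra => /eqP; rewrite /normalized => ->; rewrite mul0r. Qed.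

Lemma continuous_normalized (T : topologicalType) (w : T -> 'I_m -> R) a :
  (forall x, 0 < \sum_b w x b) -> (forall b, continuous (fun y => w y b)) ->
  continuous (fun y => normalized (w y) a).
Proof.
move=> w0 wC x; rewrite /normalized; apply: continuous_mulr; first exact: wC.
by apply: continuousV; [rewrite gt_eqF|exact: continuous_sumr].
Qed.

(** Entries all below [1/(m+1)] would sum to at most [m/(m+1) < 1]. *)
Lemma stochastic_ex x u : stochastic x -> exists a, m.+1%:R^-1 <= x u a.
Proof.
move=> [x0 x1]; apply: contrapT => /forallNP xlt.
have : \sum_a x u a <= \sum_(a < m) m.+1%:R^-1.
  by apply: ler_sum => a _; rewrite ltW// ltNge; apply/negP/xlt.
rewrite x1 sumr_const card_ord -[leRHS]mulr_natl ler_pdivlMr ?ltr0n// mul1r ler_nat.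
by rewrite ltnn.
Qed.

Lemma continuous_kuhn_weight (T : topologicalType) (r D : nat) (l h : R)
    (s : T -> 'I_r -> R) (p : {ffun 'I_r -> 'I_D.+1}) :
  (forall j, continuous (fun y => s y j)) ->
  continuous (fun y => kuhn_weight l h (s y) p).
Proof.
move=> sC; have cst (c : R) : continuous (fun _ : T => c) by exact: cst_continuous.
move=> x; apply: continuous_maxr => //; apply: continuous_subr.
  apply: (@continuous_big R _ Num.min) => [|j _ y]; first exact: min_continuous.
  by apply: continuous_addr => //; apply: continuous_subr => //; exact: sC.
apply: (@continuous_big R _ Num.max) => [|j _ y]; first exact: max_continuous.
by apply: continuous_subr => //; exact: sC.
Qed.

(** Vertex [u] sees at most one point more than the drop of the level over its time slot. The slots
    tile [[0, 1]], so these drops telescope to at most [r], however large [T] is. *)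
Lemma kuhn_weight_sum_card (r D : nat) (s : 'I_r -> R) (T : {set 'I_n}) :
  (forall j, 0 <= s j) ->
  (\sum_(u in T) #|[set p : {ffun 'I_r -> 'I_D.+1} |
     (0 < kuhn_weight (u%:R / n%:R) (u.+1%:R / n%:R) s p)%R]%SET| <= #|T| + r)%N.
Proof.
move=> s0; pose b i := kuhn_level s (i%:R / n%:R).
have b_mono i : (b i.+1 <= b i)%N.
  apply: leq_sum => j _; apply: le_truncn; rewrite lerB// ler_wpM2r ?invr_ge0//.
  by rewrite ler_nat.
have tele k : (\sum_(i < k) (b i - b i.+1) + b k = b 0)%N.
  elim: k => [|k IH]; first by rewrite big_ord0.
  by rewrite big_ord_recr /= -IH -addnA subnK.
have [->|[u0 _]] := set_0Vmem T; first by rewrite big_set0.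
have n0 : (0 < n)%N by exact: leq_ltn_trans (leq0n u0) (ltn_ord u0).
(* From time 0 to time 1 each of the [r] coordinates falls from the integer part of [s j + 1] to
   that of [s j]. *)
have b0n : (b 0 <= b n + r)%N.
  rewrite /b /kuhn_level mul0r divff ?pnatr_eq0 -?lt0n//.
  rewrite -[X in (_ + X)%N]card_ord -sum1_card -big_split /=.
  apply: leq_sum => j _; rewrite truncn_le_nat -natr1 natrD.
  have := s0 j; rewrite subr0 addrK => sj0.
  by have /andP[_] := truncn_itv sj0; rewrite -natr1; lra.
have cardP (u : 'I_n) : (#|[set p : {ffun 'I_r -> 'I_D.+1} |
     (0 < kuhn_weight (u%:R / n%:R) (u.+1%:R / n%:R) s p)%R]%SET|
     <= 1 + (b u - b u.+1))%N.
  have := @kuhn_weight_card _ r D (u%:R / n%:R) (u.+1%:R / n%:R) s.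
  have -> : (u%:R / n%:R <= u.+1%:R / n%:R :> R).
    by rewrite ler_wpM2r ?invr_ge0// ler_nat.
  have -> : (u%:R / n%:R <= 1 :> R) by rewrite ler_pdivrMr ?ltr0n// mul1r ler_nat ltnW.
  move=> /(_ isT isT s0); rewrite -/(b u) -/(b u.+1).
  by move: (b_mono u); move: (b u) (b u.+1) #|_| => b1 b2 c; lia.
apply: leq_trans; first by apply: leq_sum => u _; exact: cardP.
rewrite big_split /= sum1_card leq_add2l.
apply: (@leq_trans (\sum_(u < n) (b u - b u.+1))%N); last first.
  by have := tele n; lia.
by rewrite [leqRHS](bigID (mem T)) /= leq_addr.
Qed.

(** [G' y] averages colours chosen at the grid points around [q y], with Kuhn weights as
    coefficients. A colour heavy at its grid point still has positive weight at [q y] when the grid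
    is fine. The last bound counts pairs of a vertex and a selected grid point. *)
Lemma cellular_approximation (r : nat) (G : 'rV[R]_r -> 'I_n -> 'I_m -> R) (K : R) :
  (forall u a, continuous (fun y => G y u a)) -> (forall y, stochastic (G y)) ->
  0 < K ->
  exists (G' : 'rV[R]_r -> 'I_n -> 'I_m -> R) (q : 'rV[R]_r -> 'rV[R]_r),
  [/\ forall u a, continuous (fun y => G' y u a), forall y, stochastic (G' y),
      forall y, `|y| <= K -> q y = y,
      forall y u a, G' y u a != 0 -> G (q y) u a != 0 &
      forall y (T : {set 'I_n}),
        (#|[set a | [exists u in T, (G' y u a != 0)%R]]%SET| <= #|T| + r)%N].
Proof.
move=> GC Gst K0; have e0 : 0 < m.+1%:R^-1 :> R by rewrite invr_gt0 ltr0n.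
have [d d0 dG] := uniform_support GC K0 e0.
(* This makes the mesh [2 * K / D] at most [d]. *)
pose D := (Num.truncn (2 * K / d)).+1.
have D0 : 0 < D%:R :> R by rewrite ltr0n.
have DK : 2 * K / D%:R <= d.
  have /andP[_] := @truncn_itv _ (2 * K / d) ltac:(by rewrite divr_ge0 ?mulr_ge0// ltW).
  rewrite -/D ltr_pdivrMr// ler_pdivrMr// => /ltW; lra.
(* Clamping is the identity on [|y| <= K] because the norm is the sup norm. Then [s] locates [q y]
   in units of the mesh, and [z p] is the grid point of index [p]. *)
pose q (y : 'rV[R]_r) : 'rV[R]_r := \row_j Num.max (- K) (Num.min K (y ord0 j)).
pose s (y : 'rV[R]_r) (j : 'I_r) := D%:R * (q y ord0 j + K) / (2 * K).
pose z (p : {ffun 'I_r -> 'I_D.+1}) : 'rV[R]_r := \row_j (2 * K * (p j)%:R / D%:R - K).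
have q_itv y j : - K <= q y ord0 j <= K.
  by rewrite mxE le_max lexx/= ge_max ge_min lexx/= andbT; lra.
have s_itv y j : 0 <= s y j <= D%:R.
  have /andP[q1 q2] := q_itv y j.
  rewrite /s divr_ge0 ?mulr_ge0//; [|lra|lra].
  by rewrite ler_pdivrMr ?ler_pM2l//; lra.
have zK p : `|z p| <= K.
  apply: row_norm_le => [|j]; first exact: ltW.
  rewrite mxE ler_norml.
  have -> : 2 * K * (p j)%:R / D%:R - K = K * (2 * ((p j)%:R / D%:R) - 1) by field; lra.
  have p0 : 0 <= (p j)%:R / D%:R :> R by rewrite divr_ge0.
  have p1 : (p j)%:R / D%:R <= 1 :> R by rewrite ler_pdivrMr// mul1r ler_nat -ltnS.
  by apply/andP; split; nra.
have /choice[phi phiP] : forall pu, exists a, m.+1%:R^-1 <= G (z pu.1) pu.2 a.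
  by move=> [p u]; apply: stochastic_ex.
pose w (u : 'I_n) (p : {ffun 'I_r -> 'I_D.+1}) y :=
  kuhn_weight (u%:R / n%:R) (u.+1%:R / n%:R) (s y) p.
have sC j : continuous (fun y => s y j).
  move=> y; apply: continuous_mulr; last exact: cst_continuous.
  apply: continuous_mulr; first exact: cst_continuous.
  apply: continuous_addr; last exact: cst_continuous.
  have -> : (fun y => q y ord0 j) = (fun y => Num.max (- K) (Num.min K (y ord0 j))).
    by apply: funext => y'; rewrite mxE.
  apply: continuous_maxr; first exact: cst_continuous.
  apply: continuous_minr; first exact: cst_continuous.
  exact: coord_continuous.
(* As [0 < t < 1], a selected [p] differs from [s y] by less than 1 in each coordinate, so [z p]
   lies within one mesh of [q y]. *)
have wsupp u p y : 0 < w u p y -> 0 < G (q y) u (phi (p, u)).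
  move=> /kuhn_weight_gt0[t [ut tu tP]]; apply: (dG _ _ (zK p) _ _ _ (phiP (p, u))).
  have n0 : 0 < n%:R :> R by rewrite ltr0n (leq_ltn_trans (leq0n u) (ltn_ord u)).
  have t0 : 0 < t by apply: le_lt_trans ut; rewrite divr_ge0.
  have t1 : t < 1.
    by apply: lt_le_trans tu _; rewrite ler_pdivrMr// mul1r ler_nat.
  apply: row_norm_le => [|j]; first exact: ltW.
  have -> : (q y - z p) ord0 j = 2 * K / D%:R * (s y j - (p j)%:R).
    by rewrite /s !mxE; field; rewrite ?gt_eqF.
  rewrite normrM ger0_norm; last by rewrite divr_ge0 ?mulr_ge0// ltW.
  apply: le_trans DK; rewrite ler_piMr//; first by rewrite divr_ge0 ?mulr_ge0// ltW.
  by have /andP[] := tP j; rewrite ler_norml; lra.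
pose W y u a := \sum_(p | phi (p, u) == a) w u p y.
have W0 y u a : 0 <= W y u a by apply: sumr_ge0 => p _; exact: kuhn_weight_ge0.
have sumW y u : 0 < \sum_a W y u a.
  have n0 : 0 < n%:R :> R by rewrite ltr0n (leq_ltn_trans (leq0n u) (ltn_ord u)).
  have [|||| p wp] := @kuhn_weight_ex R r D (u%:R / n%:R) (u.+1%:R / n%:R) (s y).
  - by rewrite divr_ge0.
  - by rewrite ltr_pM2r ?invr_gt0// ltr_nat.
  - by rewrite ler_pdivrMr// mul1r ler_nat.
  - exact: s_itv.
  rewrite (bigD1 (phi (p, u)))//= ltr_wpDr ?sumr_ge0//.
  by rewrite /W (bigD1 p)//= ltr_wpDr ?sumr_ge0// => *; exact: kuhn_weight_ge0.
have Wneq0 y u a : W y u a != 0 -> exists2 p, 0 < w u p y & phi (p, u) = a.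
  move=> Wn0; apply: contrapT => H; move/eqP: Wn0; apply.
  apply: big1 => p /eqP pa; apply/eqP; apply: contrapT => wp; apply: H; exists p => //.
  by rewrite lt0r kuhn_weight_ge0 andbT; apply/negP.
exists (fun y u => normalized (W y u)), q; split.
- move=> u a; apply: continuous_normalized => // b.
  by apply: continuous_sumr => p _; apply: continuous_kuhn_weight.
- by move=> y; split=> [u a|u]; [exact: normalized_ge0|exact: normalized_sum].
- move=> y yK; apply/rowP => j; rewrite mxE.
  have := le_trans (row_coord_norm_le y j) yK; rewrite ler_norml => /andP[y1 y2].
  by rewrite min_r// max_r.
- by move=> y u a /normalized_neq0/Wneq0[p wp <-]; rewrite gt_eqF// wsupp.
- move=> y T; apply: leq_trans (@kuhn_weight_sum_card r D (s y) T _); last first.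
    by move=> j; have /andP[] := s_itv y j.
  pose P (u : 'I_n) : {set {ffun 'I_r -> 'I_D.+1}} := [set p | (0 < w u p y)%R]%SET.
  pose B : {set 'I_m} := (\bigcup_(u in T) [set phi (p, u) | p in P u])%SET.
  apply: (@leq_trans #|B|).
    apply/subset_leq_card/fintype.subsetP => a; rewrite inE => /exists_inP[u uT].
    move=> /normalized_neq0/Wneq0[p wp pa].
    by apply/bigcupP; exists u => //; apply/imsetP; exists p; rewrite ?inE.
  rewrite {}/B; elim/big_rec2: _ => [|u k B _ IH]; first by rewrite cards0.
  rewrite (leq_trans (leq_card_setU _ _))// leq_add//; exact: leq_imset_card.
Qed.
End CellularApproximation.

(** * Extension of maps over a ball, one vertex at a time *)

Section Filling.
Variables (R : realType) (n m : nat).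
Implicit Types (A : rel 'I_n) (x : 'I_n -> 'I_m -> R).

(** For the target [K_m], lying in a cell means that adjacent vertices share no colour. *)
Definition hom_point A x : Prop :=
  stochastic x /\ forall u v a, A u v -> x u a != 0 -> x v a != 0 -> False.

(* Since [F] need only be defined off the origin, it may be thought of as a
   map on the sphere of directions. *)
Definition fillable A (r : nat) : Prop :=
  forall F : 'rV[R]_r -> 'I_n -> 'I_m -> R,
    (forall u a (y : 'rV[R]_r), y != 0 -> continuous_at y (fun y => F y u a)) ->
    (forall y, y != 0 -> hom_point A (F y)) ->
    exists (G : 'rV[R]_r -> 'I_n -> 'I_m -> R) (M : R),
      [/\ 0 < M, forall u a, continuous (fun y => G y u a),
          forall y, hom_point A (G y) &
          forall y u a, M <= `|y| -> G y u a = F y u a].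

Definition mix (t p q : R) : R := t * p + (1 - t) * q.

(** [p] is constrained only for [t != 0] because it will be a value of [F], uncontrolled at the
    origin, where its coefficient vanishes. *)
Lemma mix_ge0 t p q : 0 <= t <= 1 -> (t != 0 -> 0 <= p) -> 0 <= q -> 0 <= mix t p q.
Proof.
move=> /andP[t0 t1] p0 q0; apply: addr_ge0; last by rewrite mulr_ge0 ?subr_ge0.
by have [->|/p0 p0'] := eqVneq t 0; rewrite ?mul0r ?mulr_ge0.
Qed.

Lemma mix_sum t (p q : 'I_m -> R) : (t != 0 -> \sum_a p a = 1) -> \sum_a q a = 1 ->
  \sum_a mix t (p a) (q a) = 1.
Proof.
move=> p1 q1; rewrite big_split /= -!mulr_sumr q1.
have [->|/p1 ->] := eqVneq t 0; last by rewrite !mulr1 addrC subrK.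
by rewrite mul0r add0r subr0 mulr1.
Qed.

Lemma mix_neq0 t p q : mix t p q != 0 -> t != 0 /\ p != 0 \/ t != 1 /\ q != 0.
Proof.
move=> H; apply: contrapT => /not_orP[/not_andP N1 /not_andP N2].
move/eqP: H; apply; rewrite /mix.
have -> : t * p = 0 by case: N1 => /negP/negPn/eqP ->; rewrite ?mul0r ?mulr0.
by case: N2 => /negP/negPn/eqP ->; rewrite ?mulr0 ?subrr ?mul0r ?addr0.
Qed.

Lemma max0_neq0 (t : R) : Num.max 0 t != 0 -> 0 < t.
Proof. by apply: contraNT; rewrite -leNgt => t0; rewrite max_l. Qed.

Definition ramp (M t : R) : R := Num.max 0 (Num.min 1 (t - M)).

Lemma ramp_itv M t : 0 <= ramp M t <= 1.
Proof. by rewrite le_max lexx/= ge_max ler01 ge_min lexx. Qed.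

Lemma ramp_neq0 M t : ramp M t != 0 -> M < t.
Proof.
apply: contraNT; rewrite -leNgt /ramp => tM.
by rewrite max_l// ge_min (_ : t - M <= 0) ?orbT// subr_le0.
Qed.

Lemma ramp_neq1 M t : ramp M t != 1 -> t < M + 1.
Proof.
apply: contraNT; rewrite -leNgt /ramp => tM.
by rewrite min_l ?max_r//; lra.
Qed.

(** At the origin, where [f] may be discontinuous, the mixture is saved by coinciding with [g] on
    the whole ball of radius [M]. *)
Lemma continuous_mix_ramp (r : nat) (M : R) (f g : 'rV[R]_r -> R) (y : 'rV[R]_r) :
  0 < M ->
  (y != 0 -> continuous_at y f) -> continuous_at y g ->
  continuous_at y (fun y : 'rV[R]_r => mix (ramp M `|y|) (f y) (g y)).
Proof.
move=> M0 fC gC.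
have rampC : continuous_at y (fun y : 'rV[R]_r => ramp M `|y|).
  apply: continuous_maxr; first exact: cst_continuous.
  apply: continuous_minr; first exact: cst_continuous.
  by apply: continuous_subr; [exact: norm_continuous|exact: cst_continuous].
have [y0|yn0] := eqVneq y 0; last first.
  apply: continuous_addr; apply: continuous_mulr => //; first exact: fC.
  by apply: continuous_subr => //; exact: cst_continuous.
have mixE z : `|z| <= M -> mix (ramp M `|z|) (f z) (g z) = g z.
  move=> zM; have -> : ramp M `|z| = 0.
    by apply/eqP; apply: contraT => /ramp_neq0; rewrite ltNge zM.
  by rewrite /mix mul0r add0r subr0 mul1r.
rewrite /continuous_at mixE; last by rewrite y0 normr0 ltW.
apply: cvg_trans gC; apply: (@near_eq_cvg _ _ (nbhs y) _); apply/nbhs_ballP.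
exists M => // z; rewrite -ball_normE /= y0 sub0r normrN => /ltW zM.
by rewrite mixE.
Qed.

(** [G] fills [F] for the graph in which [v] is isolated. Up to radius [M], row [v] is [W] and the
    others are [H]; row [v] moves to [F] between [M] and [M + 1], the other rows between [M + 1] and
    [M + 2]. *)
Lemma fillable_add_vertex A (r : nat) (v : 'I_n) :
  symmetric A -> irreflexive A ->
  (#|[set u | A v u]%SET| + r < m)%N ->
  fillable (fun u w => [&& A u w, u != v & w != v]) r -> fillable A r.
Proof.
move=> Asym Airr degv fillA F FC Fhom.
have [||G [M [M0 GC Ghom GF]]] := fillA F => //.
  move=> y /Fhom[Fst Fd]; split=> // u w a /and3P[uw _ _]; exact: Fd uw.
have Gst y : stochastic (G y) by case: (Ghom y).
have K0 : 0 < M + 2 by rewrite addr_gt0.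
have [G' [q [G'C G'st qE G'G G'card]]] := cellular_approximation GC Gst K0.
(* Half of the bound in [stochastic_ex], so that truncation at [e] leaves some mass in every row. *)
pose e : R := m.+1%:R^-1 / 2.
have e0 : 0 < e by rewrite divr_gt0 ?invr_gt0 ?ltr0n.
pose h y u a := Num.max 0 (G' y u a - e).
pose H y u := normalized (h y u).
have h0 y u a : 0 <= h y u a by rewrite le_max lexx.
have hsum y u : 0 < \sum_a h y u a.
  have [a ea] := stochastic_ex u (G'st y).
  rewrite (bigD1 a)//= ltr_wpDr ?sumr_ge0// lt_max; apply/orP; right.
  by rewrite subr_gt0 (lt_le_trans _ ea)// /e
    ltr_pdivrMr// ltr_pMr ?invr_gt0 ?ltr0n// ltr1n.
have Hsupp y u a : H y u a != 0 -> e < G' y u a.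
  by move=> /normalized_neq0/max0_neq0; rewrite subr_gt0.
pose b y a := Num.max 0 (e - \big[Num.max/0]_(u | A v u) G' y u a).
pose W y := normalized (b y).
have b0 y a : 0 <= b y a by rewrite le_max lexx.
have bsum y : 0 < \sum_a b y a.
  (* The neighbours of [v] use fewer than [m] colours in all, so some colour is free and keeps the
     full coefficient [e] in [b y]. *)
  have [a aP] : exists a, forall u, A v u -> G' y u a = 0.
    pose C := [set a | [exists u in [set u | A v u]%SET, (G' y u a != 0)%R]]%SET.
    have : (#|C| < #|'I_m|)%N by rewrite card_ord (leq_ltn_trans (G'card _ _)).
    have [CT|/subsetPn[a _ aC] _] := boolP ([set: 'I_m]%SET \subset C).
      by rewrite ltnNge -cardsT subset_leq_card.
    exists a => u vu; apply/eqP; apply: contraNT aC => Gn0.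
    by rewrite inE; apply/exists_inP; exists u; rewrite ?inE.
  rewrite (bigD1 a)//= ltr_wpDr ?sumr_ge0// lt_max; apply/orP; right.
  by rewrite subr_gt0; apply: bigmax_lt => // u /aP ->.
have Wsupp y a u : W y a != 0 -> A v u -> G' y u a < e.
  move=> /normalized_neq0/max0_neq0; rewrite subr_gt0 => + vu.
  by apply: le_lt_trans; exact: (le_bigmax_cond _ (fun u => G' y u a)).
pose l0 (y : 'rV[R]_r) := ramp M `|y|; pose l1 (y : 'rV[R]_r) := ramp (M + 1) `|y|.
pose L y u a := if u == v then mix (l0 y) (F y u a) (W y a)
                else mix (l1 y) (F y u a) (H y u a).
have yn0 (y : 'rV[R]_r) : M < `|y| -> y != 0.
  by move=> My; rewrite -normr_gt0 (lt_trans M0).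
have l0n0 y : l0 y != 0 -> M < `|y| by exact: ramp_neq0.
have l1n0 y : l1 y != 0 -> M + 1 < `|y| by exact: ramp_neq0.
have l0n1 y : l0 y != 1 -> `|y| < M + 1 by exact: ramp_neq1.
have l1n1 y : l1 y != 1 -> `|y| < M + 2.
  by move=> /ramp_neq1; rewrite -addrA.
(* [F] enters these rows only beyond [M + 1], where it already equals [G]. *)
have LG y u a : u != v -> L y u a != 0 -> `|y| < M + 2 -> G y u a != 0.
  move=> uv; rewrite /L (negPf uv) => /mix_neq0[[/l1n0 yM Fn0]|[_ /Hsupp Gn0]] yK.
    by rewrite GF//; lra.
  by rewrite -(qE y (ltW yK)); apply: G'G; rewrite gt_eqF// (lt_trans e0).
have LF y u a : u != v -> L y u a != 0 -> M + 1 < `|y| -> F y u a != 0.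
  move=> uv Ln0 yM; have [yK|yK] := ltP `|y| (M + 2).
    by rewrite -GF ?LG//; lra.
  move: Ln0; rewrite /L (negPf uv) => /mix_neq0[[_]//|[/l1n1]].
  by rewrite ltNge yK.
(* Beyond [M + 1], row [v] is [F] alone. Up to there its neighbours are [H] alone, supported where
   [G' > e], hence off the support of [W]. They also avoid the [F] part of row [v], which is present
   only beyond [M], where [G = F]. *)
have Lhom_v y w a : A v w -> L y v a != 0 -> L y w a != 0 -> False.
  move=> vw; have wv : w != v by apply: contraTneq vw => ->; rewrite Airr.
  move=> Lv Lw; have [yM|yM] := ltP (M + 1) `|y|.
    have [_ Fd] := Fhom y (yn0 y ltac:(lra)).
    apply: (Fd _ _ a vw); last exact: LF.
    move: Lv; rewrite /L eqxx => /mix_neq0[[_]//|[/l0n1]].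
    by rewrite ltNge (ltW yM).
  move: Lv; rewrite {1}/L eqxx => /mix_neq0[[/l0n0 My Fv]|[_ Wn0]].
    have [_ Fd] := Fhom y (yn0 y My).
    by apply: (Fd _ _ a vw) => //; rewrite -GF ?LG//; lra.
  move: Lw; rewrite /L (negPf wv) => /mix_neq0[[/l1n0]|[_ /Hsupp]].
    by rewrite ltNge yM.
  by rewrite ltNge ltW// Wsupp.
exists L, (M + 2); split=> //.
- have hC y a : continuous (fun z => h z y a).
    by move=> z; apply: continuous_maxr; [exact: cst_continuous|];
      apply: continuous_subr; [exact: G'C|exact: cst_continuous].
  have bC a : continuous (fun z => b z a).
    move=> z; apply: continuous_maxr; first exact: cst_continuous.
    apply: continuous_subr; first exact: cst_continuous.
    by apply: (@continuous_big R _ Num.max) => [|u _]; [exact: max_continuous|exact: G'C].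
  move=> u a y; rewrite /L; case: eqVneq => _; apply: continuous_mix_ramp;
    rewrite ?addr_gt0//; try exact: FC; exact: continuous_normalized.
- move=> y; split; first split=> [u a|u].
  + have F0 : M < `|y| -> 0 <= F y u a by move=> /yn0/Fhom[[]].
    rewrite /L; case: eqVneq => _; apply: mix_ge0; rewrite ?ramp_itv ?normalized_ge0//.
      by move=> /l0n0.
    by move=> /l1n0 ?; apply: F0; lra.
  + have F1 : M < `|y| -> \sum_a F y u a = 1 by move=> /yn0/Fhom[[]].
    rewrite /L; case: eqVneq => _; apply: mix_sum; rewrite ?normalized_sum//.
      by move=> /l0n0.
    by move=> /l1n0 ?; apply: F1; lra.
  move=> u w a uw Lu Lw.
  have [uv|uv] := eqVneq u v.
    by move: uw Lu Lw; rewrite uv; exact: Lhom_v.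
  have [wv|wv] := eqVneq w v.
    by move: uw Lw Lu; rewrite wv Asym; exact: Lhom_v.
  have [yK|yK] := ltP `|y| (M + 2).
    have [_ Gd] := Ghom y; apply: (Gd u w a); rewrite ?LG//.
    by rewrite uw uv.
  have [_ Fd] := Fhom y (yn0 y ltac:(lra)).
  by apply: (Fd _ _ a uw); apply: LF => //; lra.
- move=> y u a yK.
  have -> : L y u a = mix 1 (F y u a) (if u == v then W y a else H y u a).
    rewrite /L; case: eqVneq => _; congr mix; apply/eqP; apply: contraT.
      by move=> /l0n1; lra.
    by move=> /l1n1; lra.
  by rewrite /mix mul1r subrr mul0r addr0.
Qed.
End Filling.

(** * Degenerate graphs and vanishing homotopy groups *)

Section Degenerate.
Variables (R : realType) (n m : nat).

(** A constant colouring serves inside and is deformed linearly to [F] between radii 1 and 2. *)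
Lemma fillable_edgeless (A : rel 'I_n) (r : nat) : (0 < m)%N ->
  (forall u v, A u v = false) -> @fillable R n m A r.
Proof.
move=> m0 A0 F FC Fhom.
pose c (a : 'I_m) : R := (a == Ordinal m0)%:R.
have c1 : \sum_a c a = 1.
  by rewrite (bigD1 (Ordinal m0))//= /c eqxx big1 ?addr0// => a /negPf ->.
pose L y u a := mix (ramp 1 `|y|) (F y u a) (c a).
have rn0 (y : 'rV[R]_r) : ramp 1 `|y| != 0 -> y != 0.
  by move=> /ramp_neq0 y1; rewrite -normr_gt0 (lt_trans ltr01).
exists L, 2; split.
- by [].
- move=> u a y; apply: continuous_mix_ramp => //; first exact: FC.
  exact: cst_continuous.
- move=> y; split; last by move=> u v a; rewrite A0.
  split=> [u a|u].
    by apply: mix_ge0; rewrite ?ramp_itv ?ler0n// => /rn0/Fhom[[]].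
  by apply: mix_sum => // /rn0/Fhom[[]].
- move=> y u a y2; rewrite /L (_ : ramp 1 `|y| = 1).
    by rewrite /mix mul1r subrr mul0r addr0.
  by apply/eqP; apply: contraT => /ramp_neq1; lra.
Qed.

Lemma fillable_degenerate (A : rel 'I_n) (k r : nat) :
  symmetric A -> irreflexive A -> (k + r < m)%N ->
  (forall S : {set 'I_n}, S != finset.set0 ->
     exists2 v, v \in S & (#|[set u in S | A v u]%SET| <= k)%N) ->
  @fillable R n m A r.
Proof.
move=> Asym Airr krm degA.
(* Vertices outside [S] remain as isolated ones: the matrices keep their size and the induction only
   deletes edges. *)
suff fillS N (S : {set 'I_n}) : (#|S| <= N)%N ->
    @fillable R n m (fun u w => [&& A u w, u \in S & w \in S]) r.
  have := fillS _ finset.setT (leqnn _).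
  have -> // : (fun u w => [&& A u w, u \in finset.setT & w \in finset.setT]) = A.
  by apply: funext => u; apply: funext => w; rewrite !inE !andbT.
elim: N S => [|N IH] S.
  rewrite leqn0 cards_eq0 => /eqP ->; apply: fillable_edgeless => [|u w].
    exact: leq_ltn_trans krm.
  by rewrite !inE /= andbF.
have [->|Sn0] := eqVneq S finset.set0.
  by move=> _; apply: IH; rewrite cards0.
have [v vS degv] := degA S Sn0; rewrite (cardsD1 v) vS ltnS => /IH fillSv.
apply: (@fillable_add_vertex _ _ _ _ _ v).
- by move=> u w; rewrite /= Asym [(u \in S) && _]andbC.
- by move=> u; rewrite Airr.
- apply: leq_ltn_trans krm; rewrite leq_add2r (leq_trans _ degv)//.
  apply/subset_leq_card/fintype.subsetP => u; rewrite !inE => /and3P[-> _ ->] //.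
- have <- // : (fun u w => [&& A u w, u \in S :\ v & w \in S :\ v]) =
      fun u w => [&& [&& A u w, u \in S & w \in S], u != v & w != v].
    apply: funext => u; apply: funext => w.
  by rewrite !inE; case: (A u w); case: (u == v); case: (w == v);
    case: (u \in S); case: (w \in S).
Qed.

Lemma degen_le_ex (E : {set 'I_n * 'I_n}) (k : nat) (S : {set 'I_n}) :
  (degen E <= k)%N -> S != finset.set0 ->
  exists2 v, v \in S & (#|[set u in S | adj E v u]%SET| <= k)%N.
Proof.
move=> Ek Sn0; apply: contrapT => H.
have degk v : v \in S -> (k < deg_in E S v)%N.
  by move=> vS; rewrite ltnNge; apply/negP => vk; apply: H; exists v.
(* Ensures that the default value [n] of the minimum also exceeds [k]. *)
have kn : (k < n)%N.
  have [v vS] := set0Pn _ Sn0; apply: leq_trans (degk v vS) _.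
  by rewrite -[X in (_ <= X)%N]card_ord max_card.
have : (k < mindeg_in E S)%N.
  rewrite /mindeg_in; elim/big_ind: _ => // x y kx ky.
  by rewrite leq_min kx.
rewrite ltnNge (leq_trans _ Ek)//.
exact: (@leq_bigmax_cond _ (fun S : {set 'I_n} => S != finset.set0) (mindeg_in E)).
Qed.

Lemma adj_sym (E : {set 'I_n * 'I_n}) : symmetric (adj E).
Proof. by move=> u v; rewrite /adj orbC. Qed.

Lemma adj_irr (E : {set 'I_n * 'I_n}) : E \subset upairs n -> irreflexive (adj E).
Proof.
move=> /fintype.subsetP EU u; apply/negbTE/negP; rewrite /adj orbb => /EU.
by rewrite inE /= ltnn.
Qed.

Lemma hom_spaceE (E : {set 'I_n * 'I_n}) (x : 'M[R]_(n, m)) :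
  hom_space E (K_rel m) x <-> hom_point (adj E) x.
Proof.
split=> [[x0 [x1 xE]]|[[x0 x1] xE]]; do ?split=> //.
  by move=> u v a uv xu xv; have := xE u v uv a a xu xv; rewrite /K_rel eqxx.
move=> u v uv a b xu xv; apply/negP => /eqP ab; move: xu; rewrite ab => xu.
exact: (xE u v b).
Qed.

(** Precompose [f] with the radial projection [g] to the Euclidean sphere, fill, and rescale so that
    the unit sphere lands where [G] agrees with this composite. *)
Lemma fillable_pi_trivial (E : {set 'I_n * 'I_n}) (i : nat) :
  @fillable R n m (adj E) i.+1 -> pi_trivial (@hom_space R n m E (K_rel m)) i.
Proof.
move=> fillE f fC fX.
pose nrm2 (y : 'rV[R]_i.+1) := Num.sqrt (\sum_j y ord0 j ^+ 2).
have sq0 (y : 'rV[R]_i.+1) : 0 <= \sum_j y ord0 j ^+ 2.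
  by apply: sumr_ge0 => j _; exact: sqr_ge0.
have nrm2_gt0 (y : 'rV[R]_i.+1) : y != 0 -> 0 < nrm2 y.
  move=> yn0; rewrite sqrtr_gt0 lt0r sq0 andbT; apply: contraNneq yn0 => s0.
  apply/eqP/rowP => j; rewrite mxE; apply/eqP; rewrite -sqrf_eq0.
  have /psumr_eq0P : (forall j, true -> 0 <= y ord0 j ^+ 2)
    by move=> *; exact: sqr_ge0.
  by move=> /(_ s0 j isT) ->.
have nrm2Z (t : R) (y : 'rV[R]_i.+1) : 0 < t -> nrm2 (t *: y) = t * nrm2 y.
  move=> t0; rewrite /nrm2 -[t in RHS]ger0_norm ?ltW// -sqrtr_sqr -sqrtrM ?sqr_ge0//.
  by rewrite mulr_sumr; congr Num.sqrt; apply: eq_bigr => j _; rewrite mxE exprMn.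
pose g (y : 'rV[R]_i.+1) := (nrm2 y)^-1 *: y.
have gS (y : 'rV[R]_i.+1) : y != 0 -> usphere (g y).
  move=> /nrm2_gt0 y0; rewrite /usphere /=.
  have : nrm2 (g y) = 1 by rewrite nrm2Z ?invr_gt0// mulVf// gt_eqF.
  by move=> /(congr1 (fun t => t ^+ 2)); rewrite sqr_sqrtr// expr1n.
have nrm2C : continuous nrm2.
  move=> y; apply: (@continuous_comp _ _ _
    (fun y : 'rV[R]_i.+1 => \sum_j y ord0 j ^+ 2) Num.sqrt).
    apply: continuous_sumr => j _ z.
    by apply: continuous_mulr; exact: coord_continuous.
  exact: sqrt_continuous.
have gC (y : 'rV[R]_i.+1) : y != 0 -> continuous_at y (g : 'rV[R]_i.+1 -> 'rV[R]_i.+1).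
  move=> yn0; apply: continuous_mx => u a.
  rewrite (_ : (fun _ => _) = fun z => (nrm2 z)^-1 * z u a); last first.
    by apply: funext => z; rewrite mxE.
  apply: continuous_mulr; last exact: coord_continuous.
  by apply: continuousV; [rewrite gt_eqF// nrm2_gt0|exact: nrm2C].
have [|y yn0|G [M [M0 GC Ghom GF]]] := fillE (fun y => f (g y)).
- move=> u a y yn0.
  apply: (@continuous_comp _ _ _ (fun y => f (g y))
    (fun x : 'M[R]_(n, m) => x u a)); last exact: coord_continuous.
  move/subspace_continuousP: fC => /(_ _ (gS y yn0)) fgC A /fgC.
  rewrite /nbhs /= /within /= => fA.
  have zn0 : \forall z \near y, z != 0.
    apply/nbhs_ballP; exists `|y|; first by rewrite /= normr_gt0.
    by move=> z; rewrite -ball_normE /=; apply: contraTneq => ->; rewrite subr0 ltxx.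
  by have := gC y yn0 _ fA; apply: filterS2 zn0 => z zn0; apply; exact: gS.
- by apply/hom_spaceE/fX; exists (g y) => //; exact: gS.
(* A Euclidean unit vector has sup norm at least [1/(i+1)], so its multiple by [C] has sup norm at
   least [M]. *)
pose C := M * i.+1%:R.
have C0 : 0 < C by rewrite mulr_gt0 ?ltr0n.
exists (fun y => \matrix_(u, a) G (C *: y) u a); split.
- apply: continuous_subspaceT => y; apply: continuous_mx => u a.
  rewrite (_ : (fun _ => _) = (fun z : 'rV[R]_i.+1 => G (C *: z) u a)); last first.
    by apply: funext => z; rewrite mxE.
  apply: (@continuous_comp _ _ _ (fun z : 'rV[R]_i.+1 => C *: z)
    (fun z : 'rV[R]_i.+1 => G z u a)); last exact: GC.
  exact: scaler_continuous.
- move=> _ [y _ <-]; apply/hom_spaceE.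
  rewrite (_ : (fun_of_matrix _) = G (C *: y)); first exact: Ghom.
  by apply: funext => u; apply: funext => a; rewrite mxE.
- move=> y ys; apply/matrixP => u a; rewrite mxE GF.
    have nC : nrm2 (C *: y) = C.
      by rewrite nrm2Z// /nrm2 ys sqrtr1 mulr1.
    by rewrite /g nC scalerA mulVf ?gt_eqF// scale1r.
  rewrite normrZ gtr0_norm// /C -mulrA ler_peMr ?(ltW M0)//.
  rewrite leNgt; apply/negP => ylt.
  have : 1 <= i.+1%:R * `|y| ^+ 2.
    rewrite -{1}ys mulr_natl -[X in _ *+ X]card_ord -sumr_const.
    by apply: ler_sum => j _; rewrite -real_normK ?num_real//
      lerXn2r ?nnegrE// row_coord_norm_le.
  rewrite leNgt expr2 mulrA => /negP; apply.
  have i1 : 1 <= i.+1%:R :> R by rewrite ler1n.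
  have := normr_ge0 y; nra.
Qed.
End Degenerate.

(** * Monotonicity for binomial random subsets *)

Section RandomSubset.
Variables (R : realType) (I : finType).
Implicit Types (A B T : {set I}).

Definition subset_weight (p : R) T A : R := p ^+ #|A| * (1 - p) ^+ (#|T| - #|A|).

Lemma subset_weight_ge0 p T A : 0 <= p <= 1 -> 0 <= subset_weight p T A.
Proof. by move=> /andP[p0 p1]; rewrite mulr_ge0 ?exprn_ge0 ?subr_ge0. Qed.

(** Expand the product over [I] of the factors [x + y] on [T] and [0 + 1] off [T]: choices of terms
    are subsets, and those not inside [T] contribute 0. *)
Lemma exprD_subsets (x y : R) T :
  \sum_(A in powerset T) x ^+ #|A| * y ^+ (#|T| - #|A|) = (x + y) ^+ #|T|.
Proof.
pose F i : R := if i \in T then x else 0; pose G i : R := if i \in T then y else 1.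
have : \prod_i (F i + G i) = \sum_(J in {set I}) \prod_i (if i \in J then F i else G i).
  by rewrite finset.bigA_distr.
have -> : \prod_i (F i + G i) = (x + y) ^+ #|T|.
  rewrite -prodr_const (big_mkcond (mem T)) /=; apply: eq_bigr => i _.
  by rewrite /F /G; case: (i \in T); rewrite ?add0r.
move=> ->; rewrite (big_mkcond (fun A => A \in powerset T)); apply: eq_bigr => A _.
rewrite powersetE; case: ifPn => [AT|/subsetPn[i iA iT]]; last first.
  by rewrite (bigD1 i)//= iA /F (negPf iT) mul0r.
rewrite (bigID (mem A)) /=; congr (_ * _).
  rewrite -prodr_const; apply: eq_bigr => i iA.
  by rewrite iA /F (fintype.subsetP AT).
have -> : (#|T| - #|A|)%N = #|T :\: A| by rewrite cardsD (finset.setIidPr AT).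
rewrite -prodr_const [LHS]big_mkcond [RHS]big_mkcond.
apply: eq_bigr => i _; rewrite inE.
by case: (i \in A) => //=; rewrite /G; case: (i \in T).
Qed.

Lemma subset_weight_sum p T : \sum_(A in powerset T) subset_weight p T A = 1.
Proof. by rewrite exprD_subsets addrC subrK expr1n. Qed.

(* A [p q]-random subset of [T] is a [q]-random subset of a [p]-random one. *)
Lemma subset_weight_thinning (p q : R) T A : A \subset T ->
  subset_weight (p * q) T A =
  \sum_(B in powerset T | A \subset B) subset_weight p T B * subset_weight q B A.
Proof.
move=> AT.
(* With [B] the disjoint union of [A] and [C], the sum over [C] is binomial with base
   [p * (1 - q) + (1 - p) = 1 - p * q]. *)
rewrite (reindex_onto (fun C => A :|: C) (fun B => B :\: A))/=; last first.
  move=> B /andP[_ AB]; rewrite finset.setUC finset.setDE finset.setUIl finset.setUC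
    [~: A :|: A]finset.setUC finset.setUCr finset.setIT.
  exact/finset.setUidPr.
rewrite (eq_bigl (fun C => C \in powerset (T :\: A))); last first.
  move=> C; rewrite !powersetE finset.subUset AT finset.subsetUl andbT /=.
  rewrite finset.setDUl finset.setDv finset.set0U finset.subsetD.
  by congr andb; exact: (sameP eqP finset.setDidPl).
transitivity (\sum_(C in powerset (T :\: A)) (p * q) ^+ #|A| *
    ((p * (1 - q)) ^+ #|C| * (1 - p) ^+ (#|T :\: A| - #|C|))); last first.
  apply: eq_bigr => C; rewrite powersetE finset.subsetD => /andP[CT CA].
  have cU : #|A :|: C| = (#|A| + #|C|)%N.
    rewrite cardsU (_ : A :&: C = finset.set0) ?cards0 ?subn0//.
    by apply/eqP; rewrite setI_eq0 disjoint_sym.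
  rewrite /subset_weight cU cardsD (finset.setIidPr AT) addKn subnDA !exprMn exprD.
  by ring.
rewrite -mulr_sumr exprD_subsets /subset_weight cardsD (finset.setIidPr AT).
by congr (_ * _ ^+ _); ring.
Qed.

(** A coupling: with [p = p' * q], draw [B] with density [p'] and thin it to [A]; if [A] satisfies
    [P], so does [B]. *)
Lemma subset_weight_mono (p p' : R) T (P : pred {set I}) :
  0 <= p -> p <= p' -> p' <= 1 ->
  (forall A B, A \subset B -> B \subset T -> P A -> P B) ->
  \sum_(A in powerset T | P A) subset_weight p T A <=
  \sum_(A in powerset T | P A) subset_weight p' T A.
Proof.
move=> p0 pp' p'1 Pup.
have [p'0|p'0] := leP p' 0; first by have -> : p = p' by lra.
pose q := p / p'; have q01 : 0 <= q <= 1.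
  by rewrite /q divr_ge0 ?(ltW p'0)//= ler_pdivrMr// mul1r.
have -> : p = p' * q by rewrite mulrC divfK// gt_eqF.
rewrite (eq_bigr (fun A => \sum_(B in powerset T | A \subset B)
    subset_weight p' T B * subset_weight q B A)); last first.
  by move=> A; rewrite powersetE => /andP[AT _]; exact: subset_weight_thinning.
rewrite (exchange_big_dep (mem (powerset T))) /=; last by move=> A B _ /andP[].
rewrite [leRHS]big_mkcondr /=; apply: ler_sum => B; rewrite powersetE => BT.
have wB : 0 <= subset_weight p' T B by apply: subset_weight_ge0; rewrite ltW.
case: ifPn => PB; last first.
  rewrite big1// => A /andP[/andP[AT PA] /andP[_ AB]].
  by rewrite (Pup A B) in PB.
rewrite -mulr_sumr ler_piMr// -(subset_weight_sum q B).
rewrite [leLHS]big_mkcond [leRHS]big_mkcond; apply: ler_sum => A _.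
have := subset_weight_ge0 B A q01.
rewrite !powersetE BT /=.
by case: (A \subset B); case: (A \subset T); case: (P A).
Qed.
End RandomSubset.

(** * Events of the random graph *)

Section ErdosRenyi.
Variables (R : realType) (n : nat).
Implicit Types (p : R) (P Q : {set 'I_n * 'I_n} -> Prop) (E : {set 'I_n * 'I_n}).

Lemma Pr_GnpE p P :
  Pr_Gnp n p P =
  \sum_(E in powerset (upairs n) | `[< P E >]) subset_weight p (upairs n) E.
Proof. by []. Qed.

Lemma Pr_Gnp_le p P Q : 0 <= p <= 1 ->
  (forall E, E \subset upairs n -> P E -> Q E) -> Pr_Gnp n p P <= Pr_Gnp n p Q.
Proof.
move=> p01 PQ; rewrite !Pr_GnpE [leLHS]big_mkcondr [leRHS]big_mkcondr.
apply: ler_sum => E; rewrite powersetE => EU.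
have := subset_weight_ge0 (upairs n) E p01.
case: asboolP => [PE|_]; last by case: ifP.
by case: asboolP => // NQ; case: NQ; exact: PQ.
Qed.

Lemma Pr_GnpT p : Pr_Gnp n p (fun=> True) = 1.
Proof.
rewrite Pr_GnpE -[RHS](subset_weight_sum p (upairs n)).
by apply: eq_bigl => E; rewrite asboolT// andbT.
Qed.

Lemma Pr_GnpC p P : Pr_Gnp n p (fun E => ~ P E) = 1 - Pr_Gnp n p P.
Proof.
apply/eqP; rewrite eq_sym subr_eq -(subset_weight_sum p (upairs n)) !Pr_GnpE.
rewrite (bigID (fun E => `[< P E >])) /= addrC; apply/eqP; congr (_ + _).
by apply: eq_bigl => E; rewrite asbool_neg.
Qed.

Lemma Pr_Gnp_mono p p' P : 0 <= p -> p <= p' -> p' <= 1 ->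
  (forall E E', E \subset E' -> P E -> P E') -> Pr_Gnp n p P <= Pr_Gnp n p' P.
Proof.
move=> p0 pp' p'1 Pup; rewrite !Pr_GnpE; apply: subset_weight_mono => // E E' EE' _.
by move=> /asboolP PE; apply/asboolP; exact: Pup PE.
Qed.

Lemma degen_mono E E' : E \subset E' -> (degen E <= degen E')%N.
Proof.
move=> /fintype.subsetP EE'; apply/bigmax_leqP => S Sn0.
apply: leq_trans (@leq_bigmax_cond _ (fun S : {set 'I_n} => S != finset.set0)
  (mindeg_in E') S Sn0).
rewrite /mindeg_in; elim/big_ind2: _ => // [x x' y y' xx' yy'|v _].
  by rewrite leq_min !geq_min xx' yy' orbT.
apply/subset_leq_card/fintype.subsetP => u; rewrite !inE => /andP[-> ] /=.
by rewrite /adj => /orP[/EE' ->//|/EE' ->]; rewrite orbT.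
Qed.
End ErdosRenyi.

(** * Connectivity for bounded degeneracy, and passage to the limit *)

Lemma hom_space_conn (R : realType) (n m k : nat) (E : {set 'I_n * 'I_n}) :
  E \subset upairs n -> (degen E <= k)%N ->
  conn_ge (hom_space (R := R) E (K_rel m)) (m%:Z - k%:Z - 2).
Proof.
move=> EU Ek; split=> [mk|i imk].
  (* For [r = 0] the only row vector is 0, so the conditions on [F] are void and filling produces a
     point of the complex. *)
  have [||||G [M [_ _ Ghom _]]] := @fillable_degenerate R n m (adj E) k 0 (@adj_sym n E)
      (adj_irr EU) _ _ (fun _ _ _ => 0).
  - lia.
  - by move=> S; exact: degen_le_ex.
  - by move=> u a y; rewrite (_ : y = 0) ?eqxx//; apply/rowP => -[].
  - by move=> y; rewrite (_ : y = 0) ?eqxx//; apply/rowP => -[].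
  exists (\matrix_(u, a) G 0 u a); apply/hom_spaceE.
  rewrite (_ : (fun_of_matrix _) = G 0); first exact: Ghom.
  by apply: funext => u; apply: funext => a; rewrite mxE.
(* The sphere [S^i] bounds a ball of dimension [r = i + 1], and [i <= m - k - 2] says exactly that
   [k + r < m]. *)
apply/fillable_pi_trivial/(@fillable_degenerate R n m (adj E) k).
- exact: adj_sym.
- exact: adj_irr.
- lia.
- by move=> S; exact: degen_le_ex.
Qed.

Unset Implicit Arguments.

Theorem theorem5p1 (R : realType) (k : nat) (c : R) (m : nat) :
  (2 <= k)%N -> 0 < c -> (c%:E < c_thr (R := R) k.+1)%E -> (3 <= m)%N ->
  (fun n : nat =>
     Pr_Gnp n (c / n%:R)
       (fun E => conn_ge (hom_space (R := R) E (K_rel m)) (m%:Z - k%:Z - 2)))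
    @ \oo --> (1 : R).
Proof.
move=> _ c0 /ereal_sup_gt[_ [c' [c'0 c'P] <-]]; rewrite lte_fin => cc' _.
apply: (@squeeze_cvgr _ _ _ _
  (fun n : nat => 1 - Pr_Gnp n (c' / n%:R) (fun E => (k.+1 <= degen E)%N)) (fun=> 1)).
- near=> n.
  have n0 : 0 < n%:R :> R by rewrite ltr0n; near: n; exact: nbhs_infty_gt.
  (* The comparison of the two densities needs [c'/n] to be a probability, hence [n >= c']. *)
  have c'n : c' / n%:R <= 1.
    by rewrite ler_pdivrMr// mul1r; near: n; exact: nbhs_infty_ger.
  have cn : c / n%:R <= c' / n%:R by rewrite ler_pM2r ?invr_gt0// ltW.
  have cn0 : 0 <= c / n%:R by rewrite divr_ge0 ?ltW.
  have cn01 : 0 <= c / n%:R <= 1 by rewrite cn0 (le_trans cn).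
  apply/andP; split; last by rewrite -[leRHS](Pr_GnpT n (c / n%:R)) Pr_Gnp_le.
  apply: (@le_trans _ _ (Pr_Gnp n (c / n%:R) (fun E => ~ (k.+1 <= degen E)%N))).
    rewrite Pr_GnpC lerB// Pr_Gnp_mono// => E E' /degen_mono EE' kE.
    exact: leq_trans kE EE'.
  apply: Pr_Gnp_le => // E EU /negP; rewrite -ltnNge ltnS.
  exact: hom_space_conn.
- rewrite -[X in _ --> X]subr0; apply: cvgB => //; exact: cvg_cst.
- exact: cvg_cst.
Unshelve. all: by end_near. Qed.
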